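(* Let $G$ be a $\Theta$-graph such that, for every integer $p\geq 2$, $G$ is (up to isomorphism) neither $\Theta_{p,p,p}$ nor $\Theta_{p,p,p+2}$. Then $\mathrm{dim}(G)=2$.
   Context: All graphs are finite, simple and connected. A $\Theta$-graph is a graph with precisely two vertices $u,v$ of degree $3$, all other vertices of degree $2$, in which $u$ and $v$ are joined by three internally vertex-disjoint paths. It is denoted $\Theta_{p,q,r}$ when these three paths have lengths (numbers of edges) $p\le q\le r$; since graphs are simple, $q\ge 2$. For vertices $x,y$ of a graph $G$, $d(x,y)$ is the length of a shortest path between them. A vertex $s$ distinguishes two vertices $x,x'$ if $d(s,x)\neq d(s,x')$. A set $S\subseteq V(G)$ is a vertex metric generator if every pair of distinct vertices of $G$ is distinguished by some $s\in S$. The vertex metric dimension $\mathrm{dim}(G)$ is the size of a smallest vertex metric generator of $G$. *)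

(* Defs.v *)
From mathcomp Require Import all_boot.

Set Implicit Arguments.
Unset Strict Implicit.
Unset Printing Implicit Defensive.

Record graph := Graph {
  vertex :> finType;
  adj : rel vertex;
  adj_sym : symmetric adj;
  adj_irrefl : irreflexive adj;
  adj_connected : forall x y : vertex, connect adj x y
}.

Section GraphNotions.
Variable G : graph.

Definition degree (x : G) : nat := #|[set y | adj x y]|.

(* The path is x :: s; its length (number of edges) is size s. *)
Definition path_between (x y : G) (s : seq G) : bool :=
  [&& path (@adj G) x s, last x s == y & uniq (x :: s)].

(* The index at which find stops is the least n admitting a path with n edges;
   such an n < #|G| always exists since G is connected. *)
Definition dist (x y : G) : nat :=
  find (fun n => [exists s : n.-tuple G, path_between x y s]) (iota 0 #|G|).

Definition distinguishes (s x y : G) : bool := dist s x != dist s y.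

Definition metric_generator (S : {set G}) : bool :=
  [forall x, forall y, (x != y) ==> [exists s in S, distinguishes s x y]].

(* The default value setT of arg min is itself a generator, see
   metric_generator_setT below. *)
Definition metric_dim : nat :=
  #|[arg min_(S < setT | metric_generator S) #|S|]|.

(* Distinctness has to be required separately: an edge from u to v, taken
   twice, has no internal vertices and so would be disjoint from itself. *)
Definition internally_disjoint (u v : G) (s t : seq G) : Prop :=
  s <> t /\ forall w : G, w \in s -> w \in t -> w = u \/ w = v.

End GraphNotions.

Definition is_Theta (p q r : nat) (G : graph) : Prop :=
  p <= q <= r /\
  exists u v : G,
    [/\ u != v,
        degree u = 3,
        degree v = 3,
        forall w : G, w != u -> w != v -> degree w = 2 &
        exists s1 s2 s3 : seq G,
          [/\ [/\ path_between u v s1, path_between u v s2 & path_between u v s3],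
              [/\ size s1 = p, size s2 = q & size s3 = r] &
              [/\ internally_disjoint u v s1 s2,
                  internally_disjoint u v s1 s3 &
                  internally_disjoint u v s2 s3]]].

Definition Theta_graph (G : graph) : Prop := exists p q r, is_Theta p q r G.

Lemma dist_eq0 (G : graph) (x y : G) : (dist x y == 0) = (x == y).
Proof.
have Gx : 0 < #|G| by apply/card_gt0P; exists x.
rewrite /dist; case: #|G| Gx => //= n _.
case: existsP => [[s]|nos].
  by rewrite tuple0 /path_between /= andbT eqxx => ->.
apply/esym/eqP => xy; case: nos; exists [tuple].
by rewrite /path_between /= xy eqxx.
Qed.

Lemma metric_generator_setT (G : graph) : metric_generator [set: G].
Proof.
apply/forallP => x; apply/forallP => y; apply/implyP => nxy.
apply/existsP; exists x; rewrite inE /= /distinguishes.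
have /eqP -> : dist x x == 0 by rewrite dist_eq0.
by rewrite eq_sym dist_eq0.
Qed.

(* Main.v *)
Require Import Defs.
From mathcomp Require Import all_boot.
From mathcomp Require Import zify.

Set Implicit Arguments.
Unset Strict Implicit.
Unset Printing Implicit Defensive.

(** A single vertex [s] never generates: the three neighbours of a vertex [u]
    of degree 3, together with [u] itself, would be four vertices at distinct
    distances from [s], all differing by at most 1 from the distance of [u]
    ([metric_generator_gt1]). So it suffices to exhibit two landmarks.

    Let [p <= q <= r] be the lengths of the three branches. A degree count shows
    that the branches carry all vertices and all edges of the graph, so that a
    vertex is given by a branch and a position on it, and the only coincidences
    are at the two ends of the branches ([is_Theta_coordinates]). In these
    coordinates the distances from a given vertex have a closed form
    ([dist_theta]), and the problem becomes one of linear arithmetic: two points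
    with the same pair of distances have to be equal.

    The excluded graphs are those with [(q, r)] equal to [(p, p)] or [(p, p + 2)].
    Except when [(q, r)] is [(p, p + 1)] or [(p + 2, p + 2)], the landmarks are
    the points at position [(q - p + 2)./2] of the middle branch and
    [(p + r + 2)./2] of the long one ([separating_generic]). The first is nearly
    opposite to position [p - 1] of the short branch, on the cycle formed by the
    short and middle branches; the second is nearly opposite to position [0], on
    the cycle formed by the short and long branches. Hence, along the short
    branch, the distance to the first increases, except for the last step, while
    the distance to the second decreases. In the two remaining families, the
    neighbours on the middle and the long branch of a common end of the branches
    will do ([separating_special]). *)

(** * Distances and metric generators *)

Section Distance.
Variable G : graph.
Implicit Types (x y s : G) (t : seq G).

Lemma adj_closed_full (Q : G -> Prop) (u : G) :
  Q u -> (forall x y, adj x y -> Q x -> Q y) -> forall x, Q x.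
Proof.
move=> Qu adjQ x; have /connectP[t ut ->] := adj_connected u x.
elim: t u ut Qu => //= y t IHt u /andP[uy yt] Qu.
by apply: IHt yt _; apply: adjQ Qu.
Qed.

Lemma path_between_size x y t : path_between x y t -> size t < #|G|.
Proof. by case/and3P=> _ _ /card_uniqP /= <-; apply: max_card. Qed.

Lemma walk_path_between x t : path (@adj G) x t ->
  exists2 t', path_between x (last x t) t' & size t' <= size t.
Proof.
move=> xt; case: (shortenP xt) => t' xt' Ut' sub_t'; exists t'.
  by rewrite /path_between xt' eqxx Ut'.
by apply: uniq_leq_size => [|z /sub_t'] //; case/andP: Ut'.
Qed.

Lemma path_between_dist x y : exists2 t, path_between x y t & size t = dist x y.
Proof.
pose a n := [exists t : n.-tuple G, path_between x y t].
have has_a : has a (iota 0 #|G|).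
  have /connectP[t0 xt0 Ey] := adj_connected x y.
  have [t xt _] := walk_path_between xt0; rewrite -Ey in xt.
  apply/hasP; exists (size t); last by apply/existsP; exists (in_tuple t).
  by rewrite mem_iota add0n (path_between_size xt).
have /existsP[t xt] := nth_find 0 has_a; exists (val t) => //.
rewrite size_tuple nth_iota //.
by move: has_a; rewrite has_find size_iota.
Qed.

Lemma dist_le_walk x t : path (@adj G) x t -> dist x (last x t) <= size t.
Proof.
move=> xt; have [t' xt' le_t't] := walk_path_between xt.
apply: leq_trans le_t't; rewrite leqNgt; apply/negP => lt_t'.
have := before_find 0 lt_t'; rewrite nth_iota ?(path_between_size xt') //.
by move/existsP; case; exists (in_tuple t').
Qed.

Lemma dist_lipschitz s x y : adj x y -> dist s y <= (dist s x).+1.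
Proof.
move=> xy; have [t /and3P[st /eqP lt _] <-] := path_between_dist s x.
have := @dist_le_walk s (rcons t y).
by rewrite rcons_path st lt xy last_rcons size_rcons; apply.
Qed.

(** A function that vanishes at [s], changes by at most 1 along an edge, and has
    no local minimum other than [s], is the distance to [s]. *)
Lemma dist_potential s (f : G -> nat) :
    f s = 0 ->
    (forall x y, adj x y -> f y <= (f x).+1) ->
    (forall x, x != s -> exists2 y, adj x y & f y < f x) ->
  forall x, dist s x = f x.
Proof.
move=> fs0 f_lip f_desc x; apply/eqP; rewrite eqn_leq; apply/andP; split.
  have [n] := ubnP (f x); elim: n x => // n IHn x; rewrite ltnS => le_fx.
  have [-> | /f_desc[y xy lt_fy]] := eqVneq x s.
    by rewrite fs0 leqn0 dist_eq0.
  rewrite adj_sym in xy; apply: leq_trans (dist_lipschitz s xy) _.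
  by rewrite (leq_ltn_trans _ lt_fy) // IHn // (leq_trans lt_fy).
have [t /and3P[st /eqP <- _] <-] := path_between_dist s x.
rewrite -[size t]add0n -fs0; elim: t s st {fs0 f_desc} => [|y t IHt] z /=.
  by rewrite addn0.
case/andP=> zy /IHt le_fy; apply: leq_trans le_fy _.
by rewrite addnS -addSn leq_add2r f_lip.
Qed.

Lemma metric_generatorP (S : {set G}) :
  reflect (forall x y, (forall s, s \in S -> dist s x = dist s y) -> x = y)
          (metric_generator S).
Proof.
apply: (iffP forallP) => [gen x y eqS | inj x].
  apply/eqP/negPn/negP => nxy.
  have /existsP[s /andP[/eqS eq_xy]] := implyP (forallP (gen x) y) nxy.
  by rewrite /distinguishes eq_xy eqxx.
apply/forallP=> y; apply/implyP; apply: contraNT => /existsPn none.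
apply/eqP/inj => s Ss; apply/eqP/negPn.
by have := none s; rewrite Ss.
Qed.

Lemma metric_generator_gt1 (S : {set G}) (u : G) :
  2 < degree u -> metric_generator S -> 1 < #|S|.
Proof.
case/card_gt2P=> x [y [z [[]]]]; rewrite !inE => ux uy uz [xy yz zx].
move/metric_generatorP=> gen; rewrite ltnNge; apply/negP => S1.
have [s sS] : exists s, forall s', s' \in S -> s' = s.
  have [-> | [s Ss]] := set_0Vmem S; first by exists u => s'; rewrite inE.
  by exists s => s' Ss'; apply: (card_le1_eqP S1).
have inj v w : dist s v = dist s w -> v = w.
  by move=> eqd; apply: gen => s' /sS->.
have lip v : adj u v -> dist s v <= (dist s u).+1 /\ dist s u <= (dist s v).+1.
  by move=> uv; rewrite !dist_lipschitz // adj_sym.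
have ne v w : v != w -> dist s v <> dist s w by move=> /eqP nvw /inj.
have adjN v : adj u v -> u != v.
  by move=> uv; apply/eqP=> eq_uv; rewrite -eq_uv adj_irrefl in uv.
move: (ne _ _ xy) (ne _ _ yz) (ne _ _ zx) (lip _ ux) (lip _ uy) (lip _ uz).
move: (ne _ _ (adjN _ ux)) (ne _ _ (adjN _ uy)) (ne _ _ (adjN _ uz)).
by lia.
Qed.

Lemma metric_dim_eq2 (u : G) (S : {set G}) :
  2 < degree u -> metric_generator S -> #|S| <= 2 -> metric_dim G = 2.
Proof.
move=> deg_u genS S2; rewrite /metric_dim.
case: arg_minnP => [|S0 gen0 min0]; first exact: metric_generator_setT.
by apply/eqP; rewrite eqn_leq (leq_trans (min0 S genS)) ?(metric_generator_gt1 deg_u).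
Qed.

End Distance.

(** * Coordinates on a Theta-graph *)

(** The three paths between the vertices of degree 3, in order of length. *)
Inductive branch := Short | Middle | Long.

Definition eq_branch (i j : branch) : bool :=
  match i, j with
  | Short, Short | Middle, Middle | Long, Long => true
  | _, _ => false
  end.

Lemma eq_branchP i j : reflect (i = j) (eq_branch i j).
Proof. by case: i; case: j; constructor. Qed.

Definition on_branch (T : Type) (a b c : T) (i : branch) : T :=
  match i with Short => a | Middle => b | Long => c end.

(** [P i b] is the vertex at position [b] of branch [i], for [b] between [0] and
    the length [len i] of that branch; it is meaningless beyond. Position [0] is
    the same vertex on all branches, and so is position [len i]; apart from that
    the vertices [P i b] are distinct. They exhaust the graph, whose edges join
    consecutive positions of a branch. *)
Record coordinates (G : graph) (len : branch -> nat) (P : branch -> nat -> G)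
  : Prop := Coordinates {
  coord_start : forall i j, P i 0 = P j 0;
  coord_end : forall i j, P i (len i) = P j (len j);
  coord_edge : forall i b, b < len i -> adj (P i b) (P i b.+1);
  coord_adj : forall i b y, b <= len i -> adj (P i b) y ->
    exists j c, c < len j /\ (P i b = P j c /\ y = P j c.+1 \/
                              P i b = P j c.+1 /\ y = P j c);
  coord_surj : forall x, exists i b, b <= len i /\ P i b = x;
  coord_inj : forall i j b c, b <= len i -> c <= len j -> P i b = P j c ->
    [\/ i = j /\ b = c, b = 0 /\ c = 0 | b = len i /\ c = len j]
}.

Lemma mem_of_card (T : finType) (A : {set T}) (t : seq T) (y : T) :
  uniq t -> {subset t <= A} -> #|A| <= size t -> y \in A -> y \in t.
Proof.
move=> Ut tA leA Ay.
have tE : {subset t <= enum A} by move=> z /tA; rewrite mem_enum.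
have sE : size (enum A) <= size t by rewrite -cardE.
by have [_ ->] := uniq_min_size Ut tE sE; rewrite mem_enum.
Qed.

(** That the branches carry the whole graph follows by counting degrees: all
    neighbours of a vertex of a branch lie on branches, so the vertices of the
    branches form a connected component. *)
Lemma is_Theta_coordinates (G : graph) p q r : is_Theta p q r G ->
  [/\ 0 < p, 1 < q, p <= q <= r,
      exists u : G, degree u = 3 &
      exists P, @coordinates G (on_branch p q r) P].
Proof.
case=> lepqr [u [v [nuv du dv dw [s1 [s2 [s3 [[P1 P2 P3] [z1 z2 z3]]]]]]]].
case=> D12 D13 D23.
pose s := on_branch s1 s2 s3; pose len := on_branch p q r.
have szE i : size (s i) = len i by case: i.
have pS i : path_between u v (s i) by case: i.
have Dij i j : i <> j -> internally_disjoint u v (s i) (s j).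
  have sym t t' : internally_disjoint u v t t' -> internally_disjoint u v t' t.
    by case=> ne D; split=> [E|w wt wt']; [apply: ne | apply: D].
  by case: i; case: j => //= _; apply: sym.
have len_gt0 i : 0 < len i.
  have := pS i; rewrite -szE; case: (s i) => //=; rewrite /path_between /=.
  by rewrite (negPf nuv).
pose P i b := nth u (u :: s i) b.
have P0 i : P i 0 = u by [].
have PS i b : P i b.+1 = nth u (s i) b by [].
have Pl i : P i (len i) = v.
  have /and3P[_ /eqP <- _] := pS i.
  by rewrite -szE /P -last_nth.
have Ps i b : 0 < b -> b <= len i -> P i b \in s i.
  by case: b => // b _; rewrite -szE PS => /mem_nth->.
have Uu i : u \notin s i by have /and3P[_ _ /andP[]] := pS i.
have inj0 i b : b <= len i -> P i b = u -> b = 0.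
  by move=> leb E; apply/eqP; case: posnP => // bP; have := Uu i; rewrite -E Ps.
have inj1 i b c : b <= len i -> c <= len i -> P i b = P i c -> b = c.
  move=> leb lec /eqP; have /and3P[_ _ Ui] := pS i.
  by rewrite nth_uniq ?Ui //= ?ltnS ?szE // => /eqP.
have inj i j b c : b <= len i -> c <= len j -> P i b = P j c ->
    [\/ i = j /\ b = c, b = 0 /\ c = 0 | b = len i /\ c = len j].
  case: (eq_branchP i j) => [<- | ne_ij] leb lec E.
    by constructor 1; split=> //; apply: inj1 E.
  have [b0 | bP] := posnP b.
    by constructor 2; split=> //; apply: (inj0 j); rewrite -?E ?b0.
  have [c0 | cP] := posnP c.
    by constructor 2; split=> //; apply: (inj0 i); rewrite ?E ?c0.
  have := Ps i b bP leb; have := Ps j c cP lec; rewrite -E => sj si.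
  case: ((Dij i j ne_ij).2 _ si sj) => Ev.
    by have := inj0 i b leb Ev; lia.
  constructor 3; split; [apply: (inj1 i) | apply: (inj1 j)]; rewrite ?Pl //.
  by rewrite -E.
(* Two branches of length 1 would be the same path. *)
have not11 i j : i <> j -> ~ (len i = 1 /\ len j = 1).
  move=> /Dij[ne _] []; rewrite -!szE => zi zj; apply: ne.
  have := pS i; have := pS j; move: zi zj.
  case: (s i) => [|x [|]] //; case: (s j) => [|y [|]] //= _ _.
  by case/and3P=> _ /= /eqP-> _; case/and3P=> _ /= /eqP-> _.
have edge i b : b < len i -> adj (P i b) (P i b.+1).
  have /and3P[pi _ _] := pS i.
  by rewrite -szE => ltb; have := pathP u pi b ltb.
(* The neighbours of u, then those of v, on the three branches are distinct. *)
have start_ne i j : i <> j -> P i 1 <> P j 1.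
  move=> ne E; case: (inj i j 1 1 (len_gt0 i) (len_gt0 j) E); case=> // l1 l2.
  by apply: (not11 i j).
have end_ne i j : i <> j -> P i (len i).-1 <> P j (len j).-1.
  move=> ne E; move: (not11 i j ne) (len_gt0 i) (len_gt0 j).
  by case: (inj i j _ _ (leq_pred _) (leq_pred _) E); case=> //; lia.
(* The degrees of u, of v and of the inner vertices leave no room for other
   neighbours than those along the branches. *)
have adjP i b y : b <= len i -> adj (P i b) y ->
    exists j c, c < len j /\ (P i b = P j c /\ y = P j c.+1 \/
                              P i b = P j c.+1 /\ y = P j c).
  move=> leb by_.
  have yN : y \in [set z | adj (P i b) z] by rewrite inE.
  have [b0 | bP] := posnP b.
    have : y \in [:: P Short 1; P Middle 1; P Long 1].
      apply: mem_of_card yN; rewrite ?b0 ?P0; last by rewrite -/(degree u) du.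
        rewrite /= !inE negb_or !andbT.
        by rewrite -andbA; apply/and3P; split; apply/eqP; apply: start_ne.
      have edge0 j : adj u (P j 1) := edge j 0 (len_gt0 j).
      by apply/allP; rewrite /= !inE !edge0.
    rewrite !inE b0 P0; case/or3P=> /eqP->;
      [exists Short | exists Middle | exists Long]; exists 0;
      by split; [apply: len_gt0 | left].
  have [bl | nbl] := eqVneq b (len i).
    have edge' j : adj v (P j (len j).-1).
      rewrite adj_sym -(Pl j); have := edge j (len j).-1.
      by rewrite prednK //; apply.
    have : y \in [seq P j (len j).-1 | j <- [:: Short; Middle; Long]].
      apply: mem_of_card yN; rewrite ?bl ?Pl; last by rewrite -/(degree v) dv.
        rewrite /= !inE negb_or !andbT.
        by rewrite -andbA; apply/and3P; split; apply/eqP; apply: end_ne.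
      by apply/allP; rewrite /= !inE !edge'.
    rewrite !inE bl Pl; case/or3P=> /eqP->;
      [exists Short, (len Short).-1 | exists Middle, (len Middle).-1
      | exists Long, (len Long).-1];
      by split; [rewrite prednK | right; rewrite prednK // Pl].
  have ltb : b < len i by lia.
  have : y \in [:: P i b.-1; P i b.+1].
    apply: mem_of_card yN.
    - rewrite /= !inE !andbT; apply/eqP=> E.
      by move: (inj1 i b.-1 b.+1) => /(_ ltac:(lia) ltac:(lia) E); lia.
    - apply/allP; rewrite /= !inE edge // adj_sym.
      by have := edge i b.-1; rewrite prednK // => ->; rewrite ?orbT //; lia.
    rewrite -/(degree _) dw //; apply/eqP=> E.
      by have := inj0 i b leb E; lia.
    by have := inj1 i b (len i); rewrite Pl => /(_ leb (leqnn _) E); lia.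
  rewrite !inE => /orP[] /eqP->.
    exists i, b.-1; split; first lia.
    by right; rewrite prednK.
  by exists i, b; split=> //; left.
split; [exact: (len_gt0 Short) | | by [] | by exists u | ].
  rewrite ltnNge; apply/negP=> leq1; apply: (not11 Short Middle) => //=.
  by move: (len_gt0 Short) (len_gt0 Middle) => /=; lia.
exists P; split=> //; first by move=> i j; rewrite !Pl.
apply: (adj_closed_full (u := u)); first by exists Short, 0.
move=> x y xy [i [b [leb Ex]]]; rewrite -Ex in xy.
have [j [c [ltc [[_ ->] | [_ ->]]]]] := adjP i b y leb xy.
  by exists j, c.+1.
by exists j, c; split=> //; apply: ltnW.
Qed.

(** * Distances in coordinates *)

Section Landmarks.
Variables (G : graph) (len : branch -> nat) (P : branch -> nat -> G).
Hypothesis coordP : coordinates len P.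

(** A function of the position that is consistent at the ends of the branches is
    a function of the vertex. *)
Lemma coord_lift (F : branch -> nat -> nat) :
    (forall i j, F i 0 = F j 0) -> (forall i j, F i (len i) = F j (len j)) ->
  exists f : G -> nat, forall i b, b <= len i -> f (P i b) = F i b.
Proof.
move=> F0 Fl; suff: exists f, forall x i b, b <= len i -> P i b = x -> f x = F i b.
  by case=> f fP; exists f => i b leb; apply: fP.
apply: (fin_all_exists (P := fun x n =>
  forall i b, b <= len i -> P i b = x -> n = F i b)) => x.
have [i [b [leb <-]]] := coord_surj coordP x; exists (F i b) => j c lec E.
by have [[-> ->] | [-> ->] | [-> ->]] := coord_inj coordP lec leb E.
Qed.

(** [dist_potential] in coordinates. *)
Lemma coord_dist (F : branch -> nat -> nat) s :
    (forall i j, F i 0 = F j 0) -> (forall i j, F i (len i) = F j (len j)) ->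
    (forall i b, b < len i -> F i b <= (F i b.+1).+1 /\ F i b.+1 <= (F i b).+1) ->
    (exists i b, [/\ b <= len i, P i b = s & F i b = 0]) ->
    (forall i b, b <= len i -> P i b = s \/ exists j c, c < len j /\
       (P i b = P j c /\ F j c.+1 < F j c \/
        P i b = P j c.+1 /\ F j c < F j c.+1)) ->
  forall i b, b <= len i -> dist s (P i b) = F i b.
Proof.
move=> F0 Fl lip [i0 [a [lea Es Fs]]] desc.
have [f fP] := coord_lift F0 Fl.
suff dist_f x : dist s x = f x by move=> i b leb; rewrite dist_f fP.
apply: dist_potential => [|{}x y xy|{}x nxs]; first by rewrite -Es fP.
  have [i [b [leb Ex]]] := coord_surj coordP x; rewrite -Ex in xy *.
  have [j [c [ltc E]]] := coord_adj coordP leb xy.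
  have [le1 le2] := lip j c ltc.
  by case: E => -[-> ->]; rewrite !fP // ltnW.
have [i [b [leb Ex]]] := coord_surj coordP x; rewrite -Ex in nxs *.
have [Es' | [j [c [ltc E]]]] := desc i b leb; first by rewrite Es' eqxx in nxs.
case: E => -[-> ltF]; [exists (P j c.+1) | exists (P j c)];
  by rewrite ?(adj_sym (P j c.+1)) ?(coord_edge coordP) // !fP // ltnW.
Qed.

(** The length of a shortest branch among those different from [i]. *)
Definition other_min i : nat :=
  match i with
  | Short => minn (len Middle) (len Long)
  | Middle => minn (len Short) (len Long)
  | Long => minn (len Short) (len Middle)
  end.

(** The distance between position [a] of branch [i] and position [b] of branch
    [j]. For points of the same branch, a shortest path follows this branch or
    leaves it through its two ends; for points of distinct branches, it goes
    through one of the ends, which may be reached from [a] along [i] or, around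
    the other way, through another branch. *)
Definition theta_dist i a j b : nat :=
  let m := other_min i in
  if eq_branch i j then
    minn (a - b + (b - a)) (minn (a + m + (len i - b)) (b + m + (len i - a)))
  else minn (minn a (len i - a + m) + b) (minn (len i - a) (a + m) + (len j - b)).

Lemma other_min_le i j : i <> j -> other_min i <= len j.
Proof. by case: i; case: j => //= _; lia. Qed.

Lemma other_min_attained i : exists2 j, i <> j & other_min i = len j.
Proof.
case: i; rewrite /= /minn; case: ifP => _.
- by exists Middle.
- by exists Long.
- by exists Short.
- by exists Long.
- by exists Short.
- by exists Middle.
Qed.

Lemma theta_dist_same i a b : theta_dist i a i b =
  minn (a - b + (b - a))
       (minn (a + other_min i + (len i - b)) (b + other_min i + (len i - a))).
Proof. by rewrite /theta_dist; case: (eq_branchP i i). Qed.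

Lemma theta_dist_other i a j b : i <> j -> theta_dist i a j b =
  minn (minn a (len i - a + other_min i) + b)
       (minn (len i - a) (a + other_min i) + (len j - b)).
Proof. by rewrite /theta_dist; case: (eq_branchP i j). Qed.

Hypothesis len_gt0 : forall i, 0 < len i.

Lemma dist_theta i a : a <= len i ->
  forall j b, b <= len j -> dist (P i a) (P j b) = theta_dist i a j b.
Proof.
move=> lea; have lm := @other_min_le i.
pose closer x := exists j c, c < len j /\
  (x = P j c /\ theta_dist i a j c.+1 < theta_dist i a j c \/
   x = P j c.+1 /\ theta_dist i a j c < theta_dist i a j c.+1).
have [k ne_ik mk] := other_min_attained i.
have m_gt0 := len_gt0 k; rewrite -mk in m_gt0; have l_gt0 := len_gt0 i.
(* From an end of the branches, one gets closer to position a of branch i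
   either along i or along a shortest other branch k. *)
have closer0 j : P j 0 = P i a \/ closer (P j 0).
  have [-> | a_gt0] := posnP a; first by left; apply: coord_start coordP _ _.
  right; case: (leqP a (len i - a + other_min i)) => le_a.
    exists i, 0; split=> //; left; split; first exact: coord_start coordP _ _.
    by rewrite !theta_dist_same; lia.
  exists k, 0; split; first by rewrite -mk.
  left; split; first exact: coord_start coordP _ _.
  by rewrite !theta_dist_other // -mk; lia.
have closer_end j : P j (len j) = P i a \/ closer (P j (len j)).
  have [-> | nal] := eqVneq a (len i); first by left; apply: coord_end coordP _ _.
  right; case: (leqP (len i - a) (a + other_min i)) => le_a.
    exists i, (len i).-1; rewrite prednK //; split=> //; right.
    split; first exact: coord_end coordP _ _.
    by rewrite !theta_dist_same; lia.
  exists k, (len k).-1; rewrite prednK //; split=> //.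
  right; split; first exact: coord_end coordP _ _.
  by rewrite !theta_dist_other // -mk; lia.
apply: coord_dist.
- suff E j : theta_dist i a j 0 = theta_dist i a i 0 by move=> j k'; rewrite !E.
  case: (eq_branchP i j) => [<-// | ne_ij].
  by rewrite theta_dist_other // theta_dist_same; have := lm j ne_ij; lia.
- suff E j : theta_dist i a j (len j) = theta_dist i a i (len i).
    by move=> j k'; rewrite !E.
  case: (eq_branchP i j) => [<-// | ne_ij].
  by rewrite theta_dist_other // theta_dist_same; have := lm j ne_ij; lia.
- move=> j b ltb; case: (eq_branchP i j) => [Eij | ne_ij].
    by subst j; rewrite !theta_dist_same; lia.
  by rewrite !theta_dist_other //; have := lm j ne_ij; lia.
- by exists i, a; split=> //; rewrite theta_dist_same; lia.
move=> j b leb; have [-> | b_gt0] := posnP b; first exact: closer0.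
have [-> | nbl] := eqVneq b (len j); first exact: closer_end.
have up : theta_dist i a j b.+1 < theta_dist i a j b -> closer (P j b).
  by exists j, b; split; [lia | left].
have down : theta_dist i a j b.-1 < theta_dist i a j b -> closer (P j b).
  by exists j, b.-1; rewrite prednK //; split; [lia | right].
case: (eq_branchP i j) => [Eij | ne_ij].
  subst j.
  have [lt_ba | lt_ab | ->] := ltngtP b a; last by left.
    right; case: (leqP (a - b) (b + other_min i + (len i - a))) => le_F.
      by apply: up; rewrite !theta_dist_same; lia.
    by apply: down; rewrite !theta_dist_same; lia.
  right; case: (leqP (b - a) (a + other_min i + (len i - b))) => le_F.
    by apply: down; rewrite !theta_dist_same; lia.
  by apply: up; rewrite !theta_dist_same; lia.
right; set near := minn a (len i - a + other_min i).
case: (leqP (near + b) (minn (len i - a) (a + other_min i) + (len j - b))) => ?.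
  by apply: down; rewrite !theta_dist_other //; lia.
by apply: up; rewrite !theta_dist_other //; lia.
Qed.

(** Two functions of the position separate the vertices: positions at which they
    agree denote the same vertex. *)
Definition separating (F1 F2 : branch -> nat -> nat) : Prop :=
  forall i j b c, b <= len i -> c <= len j ->
    F1 i b = F1 j c -> F2 i b = F2 j c ->
  [\/ i = j /\ b = c, b = 0 /\ c = 0 | b = len i /\ c = len j].

Lemma landmarks_generator i1 a1 i2 a2 : a1 <= len i1 -> a2 <= len i2 ->
    separating (theta_dist i1 a1) (theta_dist i2 a2) ->
  metric_generator [set P i1 a1; P i2 a2].
Proof.
move=> le1 le2 inj; apply/metric_generatorP => x y eq_xy.
have [i [b [leb Ex]]] := coord_surj coordP x; rewrite -{x}Ex in eq_xy *.
have [j [c [lec Ey]]] := coord_surj coordP y; rewrite -{y}Ey in eq_xy *.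
have /eqP := eq_xy _ (set21 _ _); have /eqP := eq_xy _ (set22 _ _).
rewrite !dist_theta // => /eqP E2 /eqP E1.
have [[-> ->] | [-> ->] | [-> ->]] // := inj i j b c leb lec E1 E2.
  exact: coord_start coordP _ _.
exact: coord_end coordP _ _.
Qed.

End Landmarks.

(** * The choice of two landmarks *)

(** It is enough to compare points of the same branch, and points of two branches
    taken in one order. *)
Lemma separating_branches (len : branch -> nat) (F1 F2 : branch -> nat -> nat) :
    let meet i j := forall b c, b <= len i -> c <= len j ->
      F1 i b = F1 j c -> F2 i b = F2 j c ->
      b = 0 /\ c = 0 \/ b = len i /\ c = len j in
    (forall i b c, b <= len i -> c <= len i ->
      F1 i b = F1 i c -> F2 i b = F2 i c -> b = c) ->
    meet Short Middle -> meet Short Long -> meet Middle Long ->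
  separating len F1 F2.
Proof.
move=> meet inj SM SL ML i j b c leb lec E1 E2.
case: (eq_branchP i j) => [Eij | ne_ij].
  by subst j; constructor 1; split=> //; apply: (inj i).
have meetC k l : meet k l -> meet l k.
  move=> kl x y lex ley /esym D1 /esym D2.
  by case: (kl y x ley lex D1 D2) => -[]; [left | right].
suff: meet i j.
  by case/(_ b c leb lec E1 E2); [constructor 2 | constructor 3].
by case: i ne_ij {b leb E1 E2} => ne_ij; case: j ne_ij {c lec} => //= _;
  do ?[exact: SM | exact: SL | exact: ML]; apply: meetC.
Qed.

(** Here [q = p + 2 * k + e] and [r = p + 2 * d + g], which encodes the parities
    of [q - p] and [r - p] by [e] and [g]; so [k.+1] and [d + p + g] are
    [(q - p + 2)./2] and [(p + r + 2)./2]. The last two hypotheses say that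
    [(q, r)] is none of [(p, p + 1)], [(p, p + 2)] and [(p + 2, p + 2)]. *)
Lemma separating_generic p k e d g : 0 < p -> e <= 1 -> 1 <= g <= 2 ->
    2 * k + e <= 2 * d + g -> 0 < k + e + d ->
    ~ (k = 1 /\ e = 0 /\ d = 0) ->
  let len := on_branch p (p + 2 * k + e) (p + 2 * d + g) in
  separating len (theta_dist len Middle k.+1) (theta_dist len Long (d + p + g)).
Proof.
move=> p0 e1 g12 qr n1 n2; set q := p + 2 * k + e; set r := p + 2 * d + g => len.
(* With these landmarks, most of the minima in theta_dist simplify. *)
pose F1 i b := match i with
  | Short => if b < p then k.+1 + b else (k + p + e).-1
  | Middle => (k.+1 - b) + (b - k.+1)
  | Long => minn (k.+1 + b) (p + k + e + r - b).-1 end.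
pose F2 i b := match i with
  | Short => d + p - b
  | Middle => minn (d + p + b) (d + q - b)
  | Long => if b == 0 then d + p else (d + p + g - b) + (b - (d + p + g)) end.
have E1 i b : b <= len i -> theta_dist len Middle k.+1 i b = F1 i b.
  rewrite /theta_dist /F1 /len /q /r.
  by case: i => /= leb; first case: ltnP => ?; lia.
have E2 i b : b <= len i -> theta_dist len Long (d + p + g) i b = F2 i b.
  rewrite /theta_dist /F2 /len /q /r.
  by case: i => /= leb; last case: eqP => ?; lia.
suff sepF : separating len F1 F2.
  by move=> i j b c leb lec; rewrite !E1 ?E2 //; apply: sepF.
apply: separating_branches => [[] | | |] x y;
  rewrite [len _]/= ?[len Middle]/= ?[len Long]/= /F1 /F2 /q /r => lex ley.
- by case: ltnP => ?; case: ltnP => ?; lia.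
- by case: leqP => ?; case: leqP => ?; lia.
- by case: leqP => ?; case: leqP => ?; case: eqP => ?; case: eqP => ?; lia.
- by case: ltnP => ?; case: leqP => ?; lia.
- case: leqP => ?; case: ltnP => ?; case: eqP => ?;
    by case: (leqP y (d + p + g)) => ?; lia.
- case: leqP => ?; case: leqP => ?; case: eqP => ?;
    by case: (leqP y (d + p + g)) => ?; case: (leqP x k.+1) => ?; lia.
Qed.

Lemma separating_special p q r : 0 < p -> 1 < q ->
    q = p /\ r = p + 1 \/ q = p + 2 /\ r = p + 2 ->
  let len := on_branch p q r in
  separating len (theta_dist len Middle 1) (theta_dist len Long 1).
Proof.
move=> p0 q1 Eqr len.
pose F1 i b := match i with
  | Short => minn b.+1 (q + p - b).-1
  | Middle => (1 - b) + (b - 1)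
  | Long => minn b.+1 (q + r - b).-1 end.
pose F2 i b := match i with
  | Short => minn b.+1 (r + p - b).-1
  | Middle => minn b.+1 (r + q - b).-1
  | Long => (1 - b) + (b - 1) end.
have E1 i b : b <= len i -> theta_dist len Middle 1 i b = F1 i b.
  by rewrite /theta_dist /F1 /len; case: i => /= leb; case: Eqr => -[? ?]; lia.
have E2 i b : b <= len i -> theta_dist len Long 1 i b = F2 i b.
  by rewrite /theta_dist /F2 /len; case: i => /= leb; case: Eqr => -[? ?]; lia.
suff sepF : separating len F1 F2.
  by move=> i j b c leb lec; rewrite !E1 ?E2 //; apply: sepF.
apply: separating_branches => [[] | | |] x y;
  rewrite [len _]/= ?[len Middle]/= ?[len Long]/= /F1 /F2 => lex ley;
  by case: Eqr => -[? ?]; lia.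
Qed.

Theorem theorem14 (G : graph) (G_theta : Theta_graph G)
  (G_neither : forall p : nat, 2 <= p ->
     ~ is_Theta p p p G /\ ~ is_Theta p p (p + 2) G) :
  metric_dim G = 2.
Proof.
case: G_theta => p [q [r Gpqr]].
have [p0 q1 /andP[pq qr] [u deg_u] [P coordP]] := is_Theta_coordinates Gpqr.
have deg_u2 : 2 < degree u by rewrite deg_u.
have len_gt0 i : 0 < on_branch p q r i by case: i => /=; lia.
have dim2 a c : a <= q -> c <= r ->
    separating (on_branch p q r) (theta_dist (on_branch p q r) Middle a)
                                 (theta_dist (on_branch p q r) Long c) ->
    metric_dim G = 2.
  move=> lea lec sep.
  have gen := landmarks_generator (i1 := Middle) (i2 := Long) coordP len_gt0
                                  lea lec sep.
  apply: metric_dim_eq2 deg_u2 gen _.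
  by rewrite cards2; case: (_ != _).
have not_ppp : ~ (q = p /\ r = p).
  by move=> [Eq Er]; subst q r; case: (G_neither p q1).
have not_ppp2 : ~ (q = p /\ r = p + 2).
  by move=> [Eq Er]; subst q r; case: (G_neither p q1).
have [special | generic] :=
    boolP ((q == p) && (r == p + 1) || (q == p + 2) && (r == p + 2)).
  apply: (dim2 1 1); [lia | lia | apply: separating_special => //].
  by case/orP: special => /andP[/eqP-> /eqP->]; [left | right].
pose k := (q - p)./2; pose e := odd (q - p) : nat.
pose d := (r - p - 1)./2; pose g := (odd (r - p - 1)).+1.
have Eq : q = p + 2 * k + e by rewrite /k /e; lia.
have Er : r = p + 2 * d + g by rewrite /d /g; lia.
have e1 : e <= 1 by rewrite /e; case: odd.
have g12 : 1 <= g <= 2 by rewrite /g; case: odd.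
clearbody k e d g.
apply: (dim2 k.+1 (d + p + g)); [lia | lia |].
by rewrite Eq Er; apply: separating_generic => //; lia.
Qed.
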